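(* Let $R$ be a discrete valuation ring with uniformizer $\pi$ and valuation $\mathrm{val}_\pi$. Let $\mathcal{F}$ be a rank-1 unit sheaf over $R$ on the cycle graph $C_n$, with holonomy $h(C_n)\in R^\times$. Then: (i) If $h(C_n)=1$: $H^0(C_n;\mathcal{F})\cong R$ and $H^1(C_n;\mathcal{F})\cong R$ (both free). The barcode in degree $1$ consists of one infinite bar $[0,\infty)$. (ii) If $h(C_n)-1$ is a unit in $R$: $H^0(C_n;\mathcal{F})=0$ and $H^1(C_n;\mathcal{F})=0$. The barcode is empty. (iii) If $\mathrm{val}_\pi(h(C_n)-1)=a$ with $0<a<\infty$: $H^0(C_n;\mathcal{F})=0$ and $H^1(C_n;\mathcal{F})\cong R/\pi^a$ (pure torsion). The barcode consists of a single finite bar $[0,a)$.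
   Context: A rank-1 unit sheaf on a graph assigns the stalk $R$ to every vertex and every edge; for each oriented edge $e:u\to v$ there is a unit $m_e\in R^\times$, with restriction maps $\mathcal{F}_{u\to e}(x)=x$ and $\mathcal{F}_{v\to e}(x)=m_e x$. The cochains are $C^0=\prod_{v}R$, $C^1=\prod_e R$, the coboundary is $(ds)(e)=\mathcal{F}_{u\to e}(s(u))-\mathcal{F}_{v\to e}(s(v))=s(u)-m_e s(v)$ for $e:u\to v$, and $H^0=\ker d$, $H^1=C^1/\mathrm{im}\,d$. The cycle graph $C_n$ has vertices $v_0,\ldots,v_{n-1}$ and edges $e_i:v_i\to v_{i+1}$ (indices mod $n$), oriented along the cycle. Its holonomy is $h(C_n)=\prod_{i=0}^{n-1}m_{e_i}$. Barcode: if $H^1\cong R^b\oplus\bigoplus_j R/\pi^{a_j}$ with all $a_j\ge1$, the (degree-1) barcode is the multiset consisting of $b$ copies of $[0,\infty)$ and the intervals $[0,a_j)$. *)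

(* Defs.v *)
From HB Require Import structures.
From mathcomp Require Import all_boot all_order all_algebra.
From mathcomp Require Import finmap multiset.
From mathcomp Require Import boolp classical_sets constructive_ereal.

Set Implicit Arguments.
Unset Strict Implicit.
Unset Printing Implicit Defensive.

Import Order.TTheory GRing.Theory.
Local Open Scope ring_scope.

Section DVR.
Variable R : idomainType.

Definition is_ideal (I : set R) : Prop :=
  [/\ I 0, forall x y, I x -> I y -> I (x + y) & forall r x, I x -> I (r * x)].

Definition principal (x : R) : set R := [set y | exists r, y = r * x]%classic.

Definition is_prime_ideal (P : set R) : Prop :=
  [/\ is_ideal P, ~ P 1 & forall x y, P (x * y) -> P x \/ P y].

Definition is_pid : Prop :=
  forall I : set R, is_ideal I -> exists x, I = principal x.

(** Serre's definition: a principal ideal domain with exactly one nonzero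
    prime ideal; a uniformizer is a generator of that ideal. *)
Definition is_dvr : Prop :=
  is_pid /\ exists! P : set R, is_prime_ideal P /\ P <> [set 0]%classic.

Definition is_uniformizer (pi : R) : Prop :=
  is_prime_ideal (principal pi) /\ principal pi <> [set 0]%classic.

(** The valuation takes the value [+oo] at [0]; for [x != 0] it is the [k] such
    that [x] is a unit times [pi ^+ k].  Such a [k] exists and is unique when
    [R] is a DVR with uniformizer [pi] (the default [0] of [xget] is then never
    used). *)
Definition valuation (pi x : R) : \bar nat :=
  if x == 0 then +oo%E
  else (xget 0%N
    [set k | exists2 u, u \is a GRing.unit & x = u * pi ^+ k]%classic)%:E%E.

End DVR.

Section Submodule.
Variables (R : pzRingType) (V : lmodType R) (S : submodClosed V).

Definition submodule : Type := {x : V | x \in S}.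

HB.instance Definition _ := [isSub of submodule for sval].
HB.instance Definition _ := [Choice of submodule by <:].
HB.instance Definition _ := [SubChoice_isSubLmodule of submodule by <:].

(** [submodClosed] does not inherit from [zmodClosed], which the quotient
    construction needs; closure under opposites comes from scaling by [-1]. *)
Definition submod_pred : {pred V} := S.

HB.instance Definition _ :=
  GRing.isZmodClosed.Build V submod_pred (submodClosedP S : zmod_closed _).

Definition quotient_module : Type := Quotient.quot submod_pred.

HB.instance Definition _ := GRing.Zmodule.on quotient_module.
HB.instance Definition _ := ZmodQuotient.on quotient_module.

Definition quot_scale (a : R) (x : quotient_module) : quotient_module :=
  (\pi_quotient_module (a *: repr x))%qT.

Lemma pi_quot_scale (a : R) (x : V) :
  quot_scale a (\pi_quotient_module x)%qT = (\pi_quotient_module (a *: x))%qT.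
Proof.
apply/eqP; rewrite -Quotient.idealrBE -scalerBr; apply: (@rpredZ _ _ S).
change (repr (\pi_quotient_module x)%qT - x \in submod_pred).
by rewrite Quotient.idealrBE reprK.
Qed.

Lemma quot_scaleA a b x : quot_scale a (quot_scale b x) = quot_scale (a * b) x.
Proof. by rewrite -[x]reprK (pi_quot_scale b) !pi_quot_scale scalerA. Qed.

Lemma quot_scale1 : left_id 1 quot_scale.
Proof. by move=> x; rewrite -[x]reprK pi_quot_scale scale1r. Qed.

Lemma quot_scaleDr : right_distributive quot_scale +%R.
Proof.
move=> a x y; rewrite -[x]reprK -[y]reprK !pi_quot_scale -!raddfD /=.
by rewrite pi_quot_scale scalerDr.
Qed.

Lemma quot_scaleDl x : {morph quot_scale^~ x : a b / a + b}.
Proof.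
by move=> a b; rewrite -[x]reprK !pi_quot_scale -raddfD /= scalerDl.
Qed.

HB.instance Definition _ := GRing.Zmodule_isLmodule.Build R quotient_module
  quot_scaleA quot_scale1 quot_scaleDr quot_scaleDl.

End Submodule.

Definition lmod_iso (R : pzRingType) (U V : lmodType R) : Prop :=
  exists f : {linear U -> V}, bijective f.

Section KernelImage.
Variables (R : pzRingType) (U V : lmodType R) (f : {linear U -> V}).

Definition ker_pred : {pred U} := fun x => f x == 0.

Lemma ker_submod_closed : submod_closed ker_pred.
Proof.
split=> [|a x y]; rewrite !unfold_in ?linear0 // => /eqP fx /eqP fy.
by rewrite linearP fx fy scaler0 addr0.
Qed.
HB.instance Definition _ :=
  GRing.isSubmodClosed.Build R U ker_pred ker_submod_closed.

Definition im_pred : {pred V} := fun y => `[< exists x, f x = y >].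

Lemma im_submod_closed : submod_closed im_pred.
Proof.
split=> [|a x y]; rewrite !unfold_in; first by apply/asboolP; exists 0; rewrite linear0.
move=> /asboolP[u <-] /asboolP[v <-]; apply/asboolP.
by exists (a *: u + v); rewrite linearP.
Qed.
HB.instance Definition _ :=
  GRing.isSubmodClosed.Build R V im_pred im_submod_closed.

End KernelImage.

(** Loops and parallel edges are allowed; every edge has an orientation
    [edge_src e -> edge_tgt e]. *)
Record graph := Graph {
  vertex : finType;
  edge : finType;
  edge_src : edge -> vertex;
  edge_tgt : edge -> vertex }.

Record unit_sheaf (R : comUnitRingType) (G : graph) := UnitSheaf {
  edge_unit : edge G -> R;
  edge_unitP : forall e, edge_unit e \is a GRing.unit }.

Section Cohomology.
Variables (R : comUnitRingType) (G : graph) (F : unit_sheaf R G).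

Definition res_src (e : edge G) (x : R) : R := x.
Definition res_tgt (e : edge G) (x : R) : R := edge_unit F e * x.

Definition C0 : lmodType R := {ffun vertex G -> R^o}.
Definition C1 : lmodType R := {ffun edge G -> R^o}.

Definition coboundary (s : C0) : C1 :=
  [ffun e => res_src e (s (edge_src e)) - res_tgt e (s (edge_tgt e))].

Lemma coboundary_linear : linear coboundary.
Proof.
move=> a s t; apply/ffunP => e; rewrite !ffunE /res_src /res_tgt /=.
by rewrite mulrDr scalerBr !scalerAr opprD addrACA.
Qed.
HB.instance Definition _ :=
  GRing.isLinear.Build R C0 C1 *:%R coboundary coboundary_linear.

Definition H0 : lmodType R := submodule (ker_pred coboundary).
Definition H1 : lmodType R := quotient_module (im_pred coboundary).

End Cohomology.

(** [ordS i] is [i + 1] modulo [n]. *)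
Definition cycle_graph (n : nat) : graph :=
  @Graph 'I_n 'I_n (fun i => i) (fun i => ordS i).

Definition holonomy (R : comUnitRingType) (n : nat)
    (F : unit_sheaf R (cycle_graph n)) : R :=
  \prod_(i < n) edge_unit F i.

Section Barcode.
Variables (R : idomainType) (pi : R).

Definition pow_ideal (a : nat) : {pred R^o} := fun x => `[< principal (pi ^+ a) x >].

Lemma pow_ideal_submod_closed a : submod_closed (pow_ideal a).
Proof.
split=> [|c x y]; rewrite !unfold_in; first by apply/asboolP; exists 0; rewrite mul0r.
move=> /asboolP[r ->] /asboolP[s ->]; apply/asboolP.
by exists (c * r + s); rewrite mulrDl -mulrA.
Qed.
HB.instance Definition _ a :=
  GRing.isSubmodClosed.Build R R^o (pow_ideal a) (pow_ideal_submod_closed a).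

Definition mod_pow (a : nat) : lmodType R := quotient_module (pow_ideal a).

Fixpoint torsion_sum (s : seq nat) : lmodType R :=
  if s is a :: s' then (mod_pow a * torsion_sum s')%type else 'rV[R]_0.

(** [B] is the multiset of bars read off from some decomposition of [M]; the
    bars are intervals of filtration indices in [nat]. *)
Definition is_barcode (M : lmodType R) (B : {mset interval nat}%mset) : Prop :=
  exists (b : nat) (s : seq nat),
    [/\ all (fun a => 1 <= a)%N s,
        lmod_iso M ('rV[R]_b * torsion_sum s)%type
      & B = seq_mset (nseq b `[0%N, +oo[ ++ [seq `[0%N, a[ | a <- s])].

End Barcode.

(* Main.v *)
(** Pulling every edge value back to [v_0] along the cycle and summing gives a
    surjection [C1 -> R] under which the image of the coboundary is exactly the
    preimage of the ideal [(1 - h)]; hence [H1] is [R/(1 - h)], while [H0] is the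
    annihilator of [1 - h] in [R].  In particular [H1] is cyclic, so
    [H1/pi H1] has dimension at most one over the residue field and at most one
    summand occurs in any decomposition of [H1]; the annihilator [(1 - h)] then
    tells the possible single bars apart. *)

Require Import Defs.
From HB Require Import structures.
From mathcomp Require Import all_boot all_order all_algebra.
From mathcomp Require Import finmap multiset.
From mathcomp Require Import boolp classical_sets constructive_ereal.

Set Implicit Arguments.
Unset Strict Implicit.
Unset Printing Implicit Defensive.

Import GRing.Theory.
Local Open Scope ring_scope.

(** * Isomorphisms of modules and the first isomorphism theorem *)

Lemma lmod_iso_of_inj_surj (R : pzRingType) (U V : lmodType R)
    (f : {linear U -> V}) :
    (forall x, f x = 0 -> x = 0) -> (forall y, exists x, f x = y) ->
  lmod_iso U V.
Proof.
move=> f_inj f_surj; have [g gK] := choice f_surj.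
exists f; exists g => // x; apply/eqP; rewrite -subr_eq0; apply/eqP/f_inj.
by rewrite raddfB /= gK subrr.
Qed.

Section QuotientModule.
Variables (R : pzRingType) (V : lmodType R) (S : submodClosed V).

Definition quotient_proj (x : V) : quotient_module S :=
  (\pi_(quotient_module S) x)%qT.

Lemma quotient_proj_linear : linear quotient_proj.
Proof.
move=> a x y; rewrite /quotient_proj -[RHS]/(quot_scale _ _ + _).
by rewrite pi_quot_scale -raddfD.
Qed.
HB.instance Definition _ := GRing.isLinear.Build R V (quotient_module S) *:%R
  quotient_proj quotient_proj_linear.

Lemma quotient_proj_surj (x : quotient_module S) : exists v, quotient_proj v = x.
Proof. by exists (repr x); rewrite /quotient_proj reprK. Qed.

Lemma quotient_proj_eq0 (x : V) : (quotient_proj x == 0) = (x \in S).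
Proof.
rewrite -[0](raddf0 quotient_proj) /quotient_proj -Quotient.idealrBE subr0.
by [].
Qed.

Lemma first_isomorphism (W : lmodType R) (f : {linear V -> W}) :
    (forall w, exists v, f v = w) -> (forall v, (v \in S) = (f v == 0)) ->
  lmod_iso (quotient_module S) W.
Proof.
move=> fsurj fker.
(* Two representatives of a class differ by an element of [S], which [f] kills, so the choice made
   by [repr] does not matter. *)
pose g (x : quotient_module S) : W := f (repr x).
have gE v : g (quotient_proj v) = f v.
  apply/eqP; rewrite /g -subr_eq0 -raddfB -fker -quotient_proj_eq0 raddfB /=.
  by rewrite /quotient_proj reprK subrr.
have g_linear : linear g.
  move=> a x y.
  have [v <-] := quotient_proj_surj x; have [w <-] := quotient_proj_surj y.
  by rewrite -linearP !gE linearP.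
pose gL := HB.pack_for {linear quotient_module S -> W} g
  (GRing.isLinear.Build R (quotient_module S) W *:%R g g_linear).
apply: (@lmod_iso_of_inj_surj _ _ _ gL) => [x|w].
  have [v <-] := quotient_proj_surj x; rewrite /= gE => /eqP.
  by rewrite -fker -quotient_proj_eq0 => /eqP.
by have [v <-] := fsurj w; exists (quotient_proj v); rewrite /= gE.
Qed.

End QuotientModule.

Lemma lmod_iso_trans (R : pzRingType) (U V W : lmodType R) :
  lmod_iso U V -> lmod_iso V W -> lmod_iso U W.
Proof.
move=> [f f_bij] [g g_bij]; exists (g \o f : {linear U -> W}).
exact: bij_comp.
Qed.

(** * Annihilators, cyclic modules and small multisets *)

Definition annihilates (R : pzRingType) (M : lmodType R) (r : R) : Prop :=
  forall x : M, r *: x = 0.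

Definition cyclic_module (R : pzRingType) (M : lmodType R) : Prop :=
  exists g : M, forall x, exists r, x = r *: g.

Lemma annihilates_iso (R : pzRingType) (M N : lmodType R) (r : R) :
  lmod_iso M N -> annihilates M r <-> annihilates N r.
Proof.
move=> [f [g fK gK]]; split=> Mr x; first by rewrite -[x]gK -linearZ_LR Mr linear0.
by apply: (can_inj fK); rewrite linearZ_LR Mr linear0.
Qed.

Lemma seq_mset0 (K : choiceType) : seq_mset [::] = mset0 :> {mset K}%mset.
Proof. by rewrite -{1}(@enum_mset0 K) seq_mset_id. Qed.

Lemma seq_mset1 (K : choiceType) (x : K) : seq_mset [:: x] = [mset x]%mset.
Proof. by rewrite -[RHS]seq_mset_id enum_msetn. Qed.

(** * Uniformizers and reduction modulo [pi] *)

Section Uniformizer.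
Variables (R : idomainType) (pi : R).
Hypothesis pi_unif : is_uniformizer pi.

Lemma uniformizer_neq0 : pi != 0.
Proof.
apply/eqP => pi0; case: pi_unif => _; apply; apply/seteqP; split=> x /=.
  by case=> r ->; rewrite pi0 mulr0.
by move=> ->; exists 0; rewrite mul0r.
Qed.

Lemma uniformizer_not_unit (r : R) : r * pi <> 1.
Proof. by move=> rpi; case: pi_unif => -[_ + _] _; apply; exists r. Qed.

(** For [b < a], cancelling [pi ^+ b] would exhibit an inverse of [pi]. *)
Lemma principal_expr_le (a b : nat) :
  principal (pi ^+ a) (pi ^+ b) -> (a <= b)%N.
Proof.
case=> r piE; rewrite leqNgt; apply/negP => ltba.
apply: (@uniformizer_not_unit (r * pi ^+ (a - b).-1)).
apply: (@mulIf _ (pi ^+ b)); first by rewrite expf_neq0 ?uniformizer_neq0.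
rewrite mul1r -[r * _ * pi]mulrA -exprSr prednK ?subn_gt0 //.
by rewrite -mulrA -exprD subnK 1?ltnW.
Qed.

(** Let [g] generate the ideal [(x, pi)] and write [pi = t * g]. By primality [pi] divides [t] or
    [g]: in the first case cancelling [pi] makes [g] a unit, in the second [x] would lie in
    [(pi)]. *)
Lemma pid_uniformizer_maximal (x : R) :
  is_pid R -> ~ principal pi x -> exists u v, u * x + v * pi = 1.
Proof.
move=> pidR xNpi; case: pi_unif => -[_ _ pi_prime] _.
pose I : set R := [set y | exists u v, y = u * x + v * pi]%classic.
have [|g Ig] := pidR I.
  split=> [|y z|r y].
  - by exists 0, 0; rewrite !mul0r addr0.
  - move=> [u [v ->]] [u' [v' ->]]; exists (u + u'), (v + v').
    by rewrite !mulrDl addrACA.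
  - by move=> [u [v ->]]; exists (r * u), (r * v); rewrite mulrDr !mulrA.
have Igg : I g by rewrite Ig; exists 1; rewrite mul1r.
have [s xE] : principal g x by rewrite -Ig; exists 1, 0; rewrite mul1r mul0r addr0.
have [t piE] : principal g pi by rewrite -Ig; exists 0, 1; rewrite mul1r mul0r add0r.
have [|[t' tE]|[g' gE]] := pi_prime t g.
- by exists 1; rewrite mul1r.
- have [u [v guv]] := Igg; exists (t' * u), (t' * v).
  rewrite -!mulrA -mulrDr -guv; apply: (mulIf uniformizer_neq0).
  by rewrite mul1r [RHS]piE tE mulrAC.
- by case: xNpi; rewrite xE gE mulrA; exists (s * g').
Qed.

(** Over the residue field [R/pi], this says that [M/pi M] has dimension at most
    one. *)
Definition head_chain (M : lmodType R) : Prop :=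
  forall x y : M, exists r z, x = r *: y + pi *: z \/ y = r *: x + pi *: z.

Definition pi_divisible (M : lmodType R) : Prop :=
  forall x : M, exists z, x = pi *: z.

Lemma cyclic_head_chain (M : lmodType R) :
  is_pid R -> cyclic_module M -> head_chain M.
Proof.
move=> pidR [g gM] x y; have [a ->] := gM x; have [c ->] := gM y.
case: (pselect (principal pi c)) => [[r ->]|].
  by exists 0, (r *: g); right; rewrite scale0r add0r scalerA mulrC.
case/(pid_uniformizer_maximal pidR) => u [v uv1].
(* Modulo [pi], [u] inverts [c], so [a *: g] is congruent to [a * u] times [c *: g]. *)
exists (a * u), ((a * v) *: g); left; rewrite !scalerA -scalerDl.
by rewrite [pi * _]mulrC -!mulrA -mulrDr uv1 mulr1.
Qed.

Lemma head_chain_surj (M N : lmodType R) (f : {linear M -> N}) :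
  (forall y, exists x, f x = y) -> head_chain M -> head_chain N.
Proof.
move=> fsurj chainM y y'; have [x <-] := fsurj y; have [x' <-] := fsurj y'.
have [r [z xz]] := chainM x x'; exists r, (f z).
by case: xz => ->; rewrite linearD !linearZ; [left | right].
Qed.

(** Compare [(x, 0)] with [(0, y)] for [x] outside [pi M]: the first cannot be a multiple of the
    second modulo [pi], so the second is one of the first, which puts [y] in [pi N]. *)
Lemma head_chain_prod (M N : lmodType R) :
  head_chain (M * N)%type -> pi_divisible M \/ pi_divisible N.
Proof.
move=> chain; case: (pselect (pi_divisible M)) => [|/existsNP[x xNpi]]; first by left.
right=> y; have [r [[z z'] /= [[xE _]|[_ yE]]]] := chain (x, 0) (0, y).
  by case: xNpi; exists z; rewrite xE scaler0 add0r.
by exists z'; rewrite yE scaler0 add0r.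
Qed.

Lemma head_chain_fst (M N : lmodType R) :
  head_chain (M * N)%type -> head_chain M.
Proof. by apply: (head_chain_surj (f := fst)) => x; exists (x, 0). Qed.

Lemma head_chain_snd (M N : lmodType R) :
  head_chain (M * N)%type -> head_chain N.
Proof. by apply: (head_chain_surj (f := snd)) => x; exists (0, x). Qed.

Lemma pi_divisible_fst (M N : lmodType R) :
  pi_divisible (M * N)%type -> pi_divisible M.
Proof. by move=> div x; have [[z z'] [-> _]] := div (x, 0); exists z. Qed.

Lemma free_not_pi_divisible (b : nat) : ~ pi_divisible 'rV[R]_b.+1.
Proof.
move=> /(_ (const_mx 1))[z /rowP/(_ ord0)]; rewrite !mxE => /esym.
by rewrite mulrC; apply: uniformizer_not_unit.
Qed.

(** Of two basis vectors, one would be a multiple of the other modulo [pi]; the coordinate where the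
    former is [1] then makes [pi] invertible. *)
Lemma free_head_chain (b : nat) : head_chain 'rV[R]_b -> (b <= 1)%N.
Proof.
case: b => [|[|b]] // chain.
have [r [z]] := chain (delta_mx 0 0) (delta_mx 0 1).
by case=> /rowP E; [have := E 0 | have := E 1];
  rewrite !mxE /= mulr0 add0r => /esym; rewrite mulrC => /uniformizer_not_unit.
Qed.

(** Lifted to [R], an equation [1 = pi * v] modulo [pi ^+ a] has an error term still divisible by
    [pi], because [a] is positive; so [pi] would divide [1]. *)
Lemma mod_pow_not_pi_divisible (a : nat) : (0 < a)%N -> ~ pi_divisible (mod_pow pi a).
Proof.
case: a => // a _ /(_ (quotient_proj _ (1 : R^o)))[z].
have [v <-] := quotient_proj_surj z => /eqP.
rewrite -linearZ -subr_eq0 -raddfB quotient_proj_eq0 => /asboolP[r] /eqP.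
rewrite subr_eq => /eqP/esym; rewrite exprSr mulrA [pi *: v]mulrC -mulrDl.
exact: uniformizer_not_unit.
Qed.

(** * Annihilators and uniqueness of the barcode *)

Lemma annihilates_mod_pow (a : nat) (r : R) :
  annihilates (mod_pow pi a) r <-> principal (pi ^+ a) r.
Proof.
split=> [/(_ (quotient_proj _ (1 : R^o)))/eqP|[s ->] x].
  by rewrite -linearZ quotient_proj_eq0 => /asboolP; rewrite [r *: _]mulr1.
have [v <-] := quotient_proj_surj x; apply/eqP.
rewrite -linearZ quotient_proj_eq0; apply/asboolP; exists (s * v).
by rewrite [_ *: v]mulrAC.
Qed.

Lemma annihilates_prod (M N : lmodType R) (r : R) :
  annihilates (M * N)%type r <-> annihilates M r /\ annihilates N r.
Proof.
split=> [MNr|[Mr Nr] [x y]]; last by apply/pair_equal_spec; rewrite /= Mr Nr.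
by split=> x; [case: (MNr (x, 0)) | case: (MNr (0, x))].
Qed.

Lemma annihilates_rV0 (r : R) : annihilates 'rV[R]_0 r.
Proof. by move=> x; apply/rowP => -[]. Qed.

Lemma annihilates_rV1 (r : R) : annihilates 'rV[R]_1 r <-> r = 0.
Proof.
split=> [/(_ (const_mx 1))/rowP/(_ 0)|->]; first by rewrite !mxE mulr1.
by move=> x; rewrite scale0r.
Qed.

(** No nonzero summand of the decomposition is divisible by [pi], so two of them would contradict
    [head_chain_prod]. Each alternative carries its annihilator, so that computing the latter
    singles out the bar. *)
Lemma barcode_cyclic (M : lmodType R) (B : {mset interval nat}%mset) :
    is_pid R -> cyclic_module M -> is_barcode pi M B ->
  [\/ B = mset0 /\ forall r, annihilates M r,
      B = [mset `[0%N, +oo[]%mset /\ (forall r, annihilates M r -> r = 0)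
    | exists a, [/\ (0 < a)%N, B = [mset `[0%N, a[]%mset
        & forall r, annihilates M r <-> principal (pi ^+ a) r]].
Proof.
move=> pidR cycM [b [s [s_gt0 isoM ->]]].
have annM r : annihilates M r <-> annihilates 'rV[R]_b r /\ annihilates (torsion_sum pi s) r.
  by rewrite (annihilates_iso r isoM) annihilates_prod.
have {isoM} chain : head_chain ('rV[R]_b * torsion_sum pi s)%type.
  case: isoM => f [g fK gK]; apply: (head_chain_surj (f := f)).
    by move=> y; exists (g y).
  exact: cyclic_head_chain.
case: s s_gt0 annM chain => [|a s] /= s_gt0 annM chain.
  have := free_head_chain (head_chain_fst chain).
  case: b annM {chain} => [|[|]] //= annM _.
    constructor 1; split=> [|r]; first exact: seq_mset0.
    by apply/annM; split; exact: annihilates_rV0.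
  by constructor 2; split=> [|r /annM[/annihilates_rV1]]; first exact: seq_mset1.
move: s_gt0 => /andP[a_gt0 s_gt0].
(* A free summand cannot stand beside a torsion summand. *)
case: b annM chain => [|b] annM chain; last first.
  case: (head_chain_prod chain) => [/free_not_pi_divisible //|].
  by move=> /pi_divisible_fst /mod_pow_not_pi_divisible; case.
have := head_chain_prod (head_chain_snd chain).
case=> [/mod_pow_not_pi_divisible[] //|].
(* Nor can a second torsion summand. *)
case: s s_gt0 annM {chain} => [|a' s] /= s_gt0 annM; last first.
  move: s_gt0 => /andP[a'_gt0 _].
  by move=> /pi_divisible_fst /mod_pow_not_pi_divisible; case.
move=> _; constructor 3; exists a; split=> [||r]; [by []|exact: seq_mset1|].
rewrite annM annihilates_prod annihilates_mod_pow.
by split=> [[_ []]|] //; do ?split=> //; apply: annihilates_rV0.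
Qed.

End Uniformizer.

(** * Transport and circulation along the cycle *)

Section CycleSheaf.
Variables (R : idomainType) (n : nat) (F : unit_sheaf R (cycle_graph n.+1)).

(** Transport from [v_0] to [v_i] along the cycle; for [i = n.+1] it is the
    holonomy. *)
Definition transport (i : nat) : R :=
  \prod_(j < n.+1 | (j < i)%N) edge_unit F j.

Lemma transport0 : transport 0 = 1.
Proof. by rewrite /transport big_pred0. Qed.

Lemma transportS (i : 'I_n.+1) : transport i.+1 = transport i * edge_unit F i.
Proof.
rewrite /transport (bigD1 i) //= mulrC; congr (_ * _).
by apply: eq_bigl => j; rewrite ltnS ltn_neqAle andbC.
Qed.

Lemma transport_holonomy : transport n.+1 = holonomy F.
Proof. by apply: eq_bigl => j; rewrite ltn_ord. Qed.

Lemma transport_unit (i : nat) : transport i \is a GRing.unit.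
Proof. by apply: rpred_prod => j _; apply: edge_unitP. Qed.

Lemma coboundaryE (s : C0 R (cycle_graph n.+1)) (i : 'I_n.+1) :
  coboundary F s i = s i - edge_unit F i * s (ordS i).
Proof. by rewrite ffunE. Qed.

Lemma ordS_widen (i : 'I_n) : ordS (widen_ord (leqnSn n) i) = lift ord0 i.
Proof. by apply: val_inj; rewrite /= modn_small // ltnS. Qed.

Lemma ordS_max : ordS (@ord_max n) = ord0.
Proof. by apply: val_inj; rewrite /= modnn. Qed.

(** The weight of edge [i] is the transport to its source [v_i], because restriction from the source
    is the identity. *)
Definition circulation (y : C1 R (cycle_graph n.+1)) : R^o :=
  \sum_(i < n.+1) transport i * y i.

Lemma circulation_linear : linear circulation.
Proof.
move=> a y z; rewrite /circulation scaler_sumr -big_split; apply: eq_bigr => i _.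
by rewrite !ffunE mulrDr; congr (_ + _); apply: mulrCA.
Qed.
HB.instance Definition _ := GRing.isLinear.Build R (C1 R (cycle_graph n.+1)) R^o
  *:%R circulation circulation_linear.

Lemma circulation_surj (r : R^o) : exists y, circulation y = r.
Proof.
exists [ffun i => if i == ord0 then r else 0].
rewrite /circulation (bigD1 ord0) //= ffunE eqxx transport0 mul1r.
rewrite big1 ?addr0 // => i /negPf i0; by rewrite ffunE i0 mulr0.
Qed.

(** The sum telescopes: the target term of each edge cancels the source term of the next, leaving
    the two contributions at [v_0], with weight [1] at the start and the holonomy at the end. *)
Lemma circulation_coboundary (s : C0 R (cycle_graph n.+1)) :
  circulation (coboundary F s) = (1 - holonomy F) * s ord0.
Proof.
have -> : circulation (coboundary F s) =
    \sum_(i < n.+1) transport i * s i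
    - \sum_(i < n.+1) transport i.+1 * s (ordS i).
  rewrite -sumrB; apply: eq_bigr => i _.
  by rewrite coboundaryE transportS mulrBr mulrA.
rewrite big_ord_recl big_ord_recr /= ordS_max transport_holonomy transport0.
under [in X in _ - X]eq_bigr do rewrite ordS_widen.
by rewrite [X in _ - X]addrC opprD addrACA -mulrBl subrr addr0.
Qed.

(** For the converse, integrate [y] from [v_0] with initial value [c]; the divisibility hypothesis
    makes the solution close up after one turn. *)
Lemma im_coboundaryP (y : C1 R (cycle_graph n.+1)) :
  y \in im_pred (coboundary F) <-> principal (1 - holonomy F) (circulation y).
Proof.
split=> [/asboolP[s <-]|[c yE]].
  by exists (s ord0); rewrite circulation_coboundary mulrC.
pose T i : R := \sum_(j < n.+1 | (j < i)%N) transport j * y j.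
have T0 : T 0 = 0 by rewrite /T big_pred0.
have TS (i : 'I_n.+1) : T i.+1 = T i + transport i * y i.
  rewrite /T (bigD1 i) //= addrC; congr (_ + _).
  by apply: eq_bigl => j; rewrite ltnS ltn_neqAle andbC.
have Tn : T n.+1 = circulation y by apply: eq_bigl => j; rewrite ltn_ord.
(* Solving the edge equations successively from the value [c] at [v_0] subtracts the partial
   circulation [T i] from [c], up to transport. *)
pose s : C0 R (cycle_graph n.+1) := [ffun i : 'I_n.+1 => (transport i)^-1 * (c - T i)].
have sE (i : 'I_n.+1) : transport i * s i = c - T i.
  by rewrite ffunE mulrA mulrV ?transport_unit // mul1r.
have sSE (i : 'I_n.+1) : transport i.+1 * s (ordS i) = c - T i.+1.
  have [ltin|] := ltnP i n.
    have <- : ordS i = i.+1 :> nat by rewrite /= modn_small.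
    exact: sE.
  (* On the closing edge the target is [v_0]; with [h] the holonomy, the claim reads
     [h * c = c - c * (1 - h)]. *)
  move=> leni; have -> : i = ord_max.
    by apply: val_inj; apply/eqP; rewrite eqn_leq leni -ltnS ltn_ord.
  rewrite ordS_max transport_holonomy Tn yE.
  have := sE ord0; rewrite transport0 mul1r => ->.
  by rewrite /= T0 subr0 mulrBr mulr1 mulrC subKr.
apply/asboolP; exists s; apply/ffunP => i.
apply: (mulrI (transport_unit i)); rewrite coboundaryE mulrBr mulrA -transportS.
by rewrite sE sSE TS opprB addrC addrA subrK addrC addKr.
Qed.

(** The edge equations give the first claim by induction along the cycle; the second is the
    circulation of the zero coboundary. *)
Lemma ker_coboundaryP (s : C0 R (cycle_graph n.+1)) :
  s \in ker_pred (coboundary F) ->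
  (forall i : 'I_n.+1, transport i * s i = s ord0)
  /\ (1 - holonomy F) * s ord0 = 0.
Proof.
move=> /eqP ds0; split; last first.
  by rewrite -circulation_coboundary ds0 linear0.
case=> i; elim: i => [|i IHi] lti.
  by rewrite transport0 mul1r; congr (s _); apply: val_inj.
rewrite -(IHi (ltnW lti)); set j := Ordinal (ltnW lti).
have := coboundaryE s j; rewrite ds0 ffunE => /esym/eqP; rewrite subr_eq0 => /eqP ->.
rewrite mulrA -(transportS j); congr (_ * s _).
by apply: val_inj; rewrite /= modn_small.
Qed.

(** * Cohomology of the cycle *)

Lemma H0_eq0 : holonomy F != 1 -> forall x : H0 F, x = 0.
Proof.
move=> hN1 x; apply: val_inj; apply/ffunP => i.
have [sE /eqP] := ker_coboundaryP (valP x).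
rewrite mulf_eq0 subr_eq0 eq_sym (negPf hN1) => /eqP s0.
apply: (mulrI (transport_unit i)).
by rewrite sE s0 [in RHS]ffunE mulr0.
Qed.

Lemma H0_free : holonomy F = 1 -> lmod_iso (H0 F) R^o.
Proof.
move=> h1.
pose g (x : H0 F) : R^o := val x ord0.
have g_linear : linear g by move=> a x y; rewrite /g linearP !ffunE.
pose gL := HB.pack_for {linear H0 F -> R^o} g
  (GRing.isLinear.Build R (H0 F) R^o *:%R g g_linear).
apply: (@lmod_iso_of_inj_surj _ _ _ gL) => [x gx0|c].
  apply: val_inj; apply/ffunP => i; apply: (mulrI (transport_unit i)).
  have [-> _] := ker_coboundaryP (valP x).
  by rewrite [in RHS]ffunE mulr0.
(* The flat section with value [c] at [v_0]; it closes up on the last edge because the holonomy is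
   [1]. *)
pose s : C0 R (cycle_graph n.+1) := [ffun i : 'I_n.+1 => (transport i)^-1 * c].
have sE (i : 'I_n.+1) : transport i * s i = c.
  by rewrite ffunE mulrA mulrV ?transport_unit // mul1r.
have s0 : s ord0 = c by rewrite -(sE ord0) /= transport0 mul1r.
have s_ker : s \in ker_pred (coboundary F).
  apply/eqP/ffunP => i; apply: (mulrI (transport_unit i)).
  rewrite coboundaryE mulrBr mulrA -transportS sE [in RHS]ffunE mulr0.
  have [ltin|leni] := ltnP i n.
    have <- : ordS i = i.+1 :> nat by rewrite /= modn_small.
    by rewrite sE subrr.
  have -> : i = ord_max.
    by apply: val_inj; apply/eqP; rewrite eqn_leq leni -ltnS ltn_ord.
  by rewrite ordS_max transport_holonomy h1 mul1r s0 subrr.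
by exists (exist _ s s_ker); rewrite /= /g /= s0.
Qed.

(** A cochain [y0] of circulation [1] gives a generator: subtracting [circulation y] times [y0] from
    [y] leaves circulation [0], hence a coboundary. *)
Lemma H1_cyclic : cyclic_module (H1 F).
Proof.
have [y0 y01] := circulation_surj 1.
exists (quotient_proj _ y0) => x; have [y <-] := quotient_proj_surj x.
exists (circulation y); apply/eqP.
rewrite -linearZ -subr_eq0 -raddfB quotient_proj_eq0; apply/im_coboundaryP.
by exists 0; rewrite mul0r linearB linearZ /= y01 [_ *: _]mulr1 subrr.
Qed.

Lemma annihilates_H1 (r : R) :
  annihilates (H1 F) r <-> principal (1 - holonomy F) r.
Proof.
split=> [rH1|[t ->] x].
  have [y0 y01] := circulation_surj 1.
  have /eqP := rH1 (quotient_proj _ y0).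
  rewrite -linearZ quotient_proj_eq0 => /im_coboundaryP.
  by rewrite linearZ /= y01 [_ *: _]mulr1.
have [y <-] := quotient_proj_surj x; apply/eqP.
rewrite -linearZ quotient_proj_eq0; apply/im_coboundaryP.
by exists (t * circulation y); rewrite linearZ /= [_ *: _]mulrAC.
Qed.

Lemma H1_free : holonomy F = 1 -> lmod_iso (H1 F) R^o.
Proof.
move=> h1; apply: (first_isomorphism (f := circulation)) => [|y].
  exact: circulation_surj.
apply/idP/eqP => /= [/im_coboundaryP[c ->]|y0]; first by rewrite h1 subrr mulr0.
by apply/im_coboundaryP; exists 0; rewrite mul0r.
Qed.

Lemma H1_eq0 : holonomy F - 1 \is a GRing.unit -> forall x : H1 F, x = 0.
Proof.
rewrite -unitrN opprB => hU x; have [y <-] := quotient_proj_surj x; apply/eqP.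
rewrite quotient_proj_eq0; apply/im_coboundaryP.
by exists (circulation y / (1 - holonomy F)); rewrite divrK.
Qed.

(** Circulation followed by reduction modulo [pi ^+ a] has the image of the coboundary as kernel,
    since [1 - holonomy F] is [pi ^+ a] times the unit [- u]. *)
Lemma H1_torsion (pi u : R) (a : nat) :
    u \is a GRing.unit -> holonomy F - 1 = u * pi ^+ a ->
  lmod_iso (H1 F) (mod_pow pi a).
Proof.
move=> uU hE.
apply: (first_isomorphism
  (f := (@quotient_proj R R^o (pow_ideal pi a)) \o circulation)) => [x|y].
  have [r <-] := quotient_proj_surj x; have [y <-] := circulation_surj r.
  by exists y.
rewrite /= quotient_proj_eq0; have hE' : 1 - holonomy F = - u * pi ^+ a.
  by rewrite -opprB hE mulNr.
apply/idP/asboolP => [/im_coboundaryP[c ->]|[c yE]].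
  by exists (c * - u); rewrite hE' mulrA.
apply/im_coboundaryP; exists (- (c / u)).
by rewrite hE' mulrA mulrNN divrK.
Qed.

End CycleSheaf.

(** * Existence of the barcodes *)

(** [is_barcode] always displays a free factor, and [torsion_sum] ends in ['rV[R]_0], so zero
    factors must be inserted on either side. *)
Lemma lmod_iso_prodr0 (R : nzRingType) (M : lmodType R) :
  lmod_iso M (M * 'rV[R]_0)%type.
Proof.
pose g (x : M) : (M * 'rV[R]_0)%type := (x, 0).
have g_linear : linear g.
  by move=> a x y; apply/pair_equal_spec; rewrite /= scaler0 addr0.
pose gL := HB.pack_for {linear M -> (M * 'rV[R]_0)%type} g
  (GRing.isLinear.Build R M (M * 'rV[R]_0)%type *:%R g g_linear).
apply: (@lmod_iso_of_inj_surj _ _ _ gL) => [x [] //|[x v]].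
by exists x; rewrite /= /g [v]thinmx0.
Qed.

Lemma lmod_iso_prod0r (R : nzRingType) (M : lmodType R) :
  lmod_iso M ('rV[R]_0 * M)%type.
Proof.
pose g (x : M) : ('rV[R]_0 * M)%type := (0, x).
have g_linear : linear g.
  by move=> a x y; apply/pair_equal_spec; rewrite /= scaler0 addr0.
pose gL := HB.pack_for {linear M -> ('rV[R]_0 * M)%type} g
  (GRing.isLinear.Build R M ('rV[R]_0 * M)%type *:%R g g_linear).
apply: (@lmod_iso_of_inj_surj _ _ _ gL) => [x [] //|[v x]].
by exists x; rewrite /= /g [v]thinmx0.
Qed.

Lemma lmod_iso_rV1 (R : nzRingType) : lmod_iso R^o 'rV[R]_1.
Proof.
pose g (x : R^o) : 'rV[R]_1 := const_mx x.
have g_linear : linear g by move=> a x y; apply/rowP => i; rewrite !mxE.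
pose gL := HB.pack_for {linear R^o -> 'rV[R]_1} g
  (GRing.isLinear.Build R R^o 'rV[R]_1 *:%R g g_linear).
apply: (@lmod_iso_of_inj_surj _ _ _ gL) => [x /rowP/(_ 0)|v].
  by rewrite !mxE.
by exists (v 0 0); apply/rowP => i; rewrite mxE ord1.
Qed.

Lemma lmod_iso_rV0 (R : nzRingType) (M : lmodType R) :
  (forall x : M, x = 0) -> lmod_iso M 'rV[R]_0.
Proof.
move=> M0; apply: (@lmod_iso_of_inj_surj _ _ _ (\0 : {linear M -> 'rV[R]_0})).
  by move=> x _.
by move=> v; exists 0; rewrite [v]thinmx0.
Qed.

Section BarcodeExistence.
Variables (R : idomainType) (pi : R) (M : lmodType R).

Lemma barcode_free : lmod_iso M R^o -> is_barcode pi M [mset `[0%N, +oo[]%mset.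
Proof.
move=> isoM; exists 1%N, [::]; split=> //; last by rewrite -seq_mset1.
apply: lmod_iso_trans isoM _; apply: lmod_iso_trans (lmod_iso_rV1 R) _.
exact: lmod_iso_prodr0.
Qed.

Lemma barcode_zero : (forall x : M, x = 0) -> is_barcode pi M mset0.
Proof.
move=> M0; exists 0%N, [::]; split=> //; last by rewrite -seq_mset0.
exact: lmod_iso_trans (lmod_iso_rV0 M0) (lmod_iso_prodr0 _).
Qed.

Lemma barcode_torsion (a : nat) :
  (0 < a)%N -> lmod_iso M (mod_pow pi a) -> is_barcode pi M [mset `[0%N, a[]%mset.
Proof.
move=> a_gt0 isoM; exists 0%N, [:: a]; split; first by rewrite /= a_gt0.
  apply: lmod_iso_trans isoM _; apply: lmod_iso_trans (lmod_iso_prodr0 _) _.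
  exact: lmod_iso_prod0r.
by rewrite -seq_mset1.
Qed.

End BarcodeExistence.

(** * The valuation and the three cases of the holonomy *)

(** A positive value is not the default [0] of [xget], so it comes from an actual factorization. *)
Lemma valuation_gt0E (R : idomainType) (pi x : R) (a : nat) :
    (0 < a)%N -> valuation pi x = a%:E%E ->
  exists2 u, u \is a GRing.unit & x = u * pi ^+ a.
Proof.
rewrite /valuation; case: ifP => // _ a_gt0 [aE].
by move: a_gt0; rewrite -aE; case: xgetP.
Qed.

Theorem theorem5p5 (R : idomainType) (pi : R)
    (hR : is_dvr R) (hpi : is_uniformizer pi)
    (n : nat) (hn : (0 < n)%N) (F : unit_sheaf R (cycle_graph n)) :
  [/\ holonomy F = 1 ->
        [/\ lmod_iso (H0 F) R^o, lmod_iso (H1 F) R^o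
          & forall B : {mset interval nat}%mset,
              is_barcode pi (H1 F) B <-> B = [mset `[0%N, +oo[ ]%mset],
      holonomy F - 1 \is a GRing.unit ->
        [/\ forall x : H0 F, x = 0, forall x : H1 F, x = 0
          & forall B : {mset interval nat}%mset,
              is_barcode pi (H1 F) B <-> B = mset0]
    & forall a : nat, (0 < a)%N -> valuation pi (holonomy F - 1) = a%:E%E ->
        [/\ forall x : H0 F, x = 0, lmod_iso (H1 F) (mod_pow pi a)
          & forall B : {mset interval nat}%mset,
              is_barcode pi (H1 F) B <-> B = [mset `[0%N, a[ ]%mset]].
Proof.
case: n hn F => // n _ F; have [pidR _] := hR.
have pow_neq0 k : pi ^+ k != 0 by rewrite expf_neq0 ?(uniformizer_neq0 hpi).
have barcodeP B := @barcode_cyclic _ _ hpi _ B pidR (H1_cyclic F).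
split=> [h1|hU|a a_gt0 /(valuation_gt0E a_gt0)[u uU hE]].
- split=> [||B]; [exact: H0_free|exact: H1_free|].
  split=> [/barcodeP|->]; last exact/barcode_free/H1_free.
  (* A zero annihilator rules out the empty barcode, which would put [1] in it, and a bar of length
     [k], which would put [pi ^+ k] in it. *)
  have annH r : annihilates (H1 F) r -> r = 0.
    by move=> /annihilates_H1[s ->]; rewrite h1 subrr mulr0.
  case=> [[_ /(_ 1)/annH/eqP]|[] //|[k [_ _ annk]]]; first by rewrite oner_eq0.
  have /annH/eqP : annihilates (H1 F) (pi ^+ k).
    by apply/annk; exists 1; rewrite mul1r.
  by rewrite (negPf (pow_neq0 k)).
- have hN1 : holonomy F != 1.
    by apply: contraTneq hU => ->; rewrite subrr unitr0.
  split=> [||B]; [exact: H0_eq0|exact: H1_eq0|].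
  split=> [/barcodeP|->]; last exact/barcode_zero/H1_eq0.
  (* With [1] in the annihilator, an infinite bar would give [1 = 0], and a bar of length [k] would
     give [k <= 0]. *)
  have ann1 : annihilates (H1 F) 1 by move=> x; apply: H1_eq0.
  case=> [[] //|[_ /(_ 1 ann1)/eqP]|[k [k_gt0 _ /(_ 1)[/(_ ann1) + _]]]].
    by rewrite oner_eq0.
  by rewrite -(expr0 pi) => /(principal_expr_le hpi); rewrite leqNgt k_gt0.
have hN1 : holonomy F != 1.
  by rewrite -subr_eq0 hE mulf_neq0 ?pow_neq0 //; apply: contraTneq uU => ->; rewrite unitr0.
have isoH := H1_torsion uU hE.
split=> [||B]; [exact: H0_eq0|exact: isoH|].
split=> [/barcodeP|->]; last exact: barcode_torsion.
(* The annihilator [(pi ^+ a)] is proper and nonzero, which leaves only a finite bar; equality of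
   [(pi ^+ k)] and [(pi ^+ a)] then fixes its length. *)
have annH r : annihilates (H1 F) r <-> principal (pi ^+ a) r.
  by rewrite (annihilates_iso r isoH) annihilates_mod_pow.
have self k : principal (pi ^+ k) (pi ^+ k) by exists 1; rewrite mul1r.
case=> [[_ /(_ 1)/annH]|[_ /(_ (pi ^+ a))]|[k [_ -> annk]]].
- by rewrite -(expr0 pi) => /(principal_expr_le hpi); rewrite leqNgt a_gt0.
- by move=> /(_ (proj2 (annH _) (self a)))/eqP; rewrite (negPf (pow_neq0 a)).
- suff -> : k = a by [].
  apply/eqP; rewrite eqn_leq; apply/andP; split; apply: (principal_expr_le hpi).
    by apply/annk/annH.
  by apply/annH/annk.
Qed.
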